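(* Let $R$ be a principal ideal domain and let $(G,A)$ be an edge-labeled connected graph with $n$ vertices and nonzero edge labels in $R$. Then the module $R_G$ of generalized splines is a free $R$-module, and it has a flow-up class basis. Moreover, if $\mathcal{B}=\{B_1,\dots,B_n\}\subset R_G$, where for each $1\le i\le n$ the spline $B_i$ is a minimal element of the flow-up class $\mathcal{F}_{i-1}$, then $\mathcal{B}$ is a flow-up class basis of $R_G$.
   Context: Graphs are finite, and each edge joins two distinct vertices. For a connected graph $G$ with ordered vertices $v_1,\dots,v_n$, edges $e_1,\dots,e_m$ and edge labels $A=\{a_1,\dots,a_m\}\subseteq R$ ($a_k$ being the label of $e_k$), a generalized spline on $G$ over $R$ is a tuple $(f_1,\dots,f_n)\in R^n$ such that whenever $v_i$ and $v_j$ are joined by the edge $e_k$, $f_i-f_j\in\langle a_k\rangle$. The set $R_G$ of all generalized splines is an $R$-submodule of $R^n$. For $0\le i<n$, the $i$th flow-up class $\mathcal{F}_i$ is the set of splines $F=(0,\dots,0,f_{i+1},\dots,f_n)\in R_G$ with exactly $i$ leading zeros, i.e. $f_1=\dots=f_i=0$ and $f_{i+1}\neq0$; also $\mathcal{F}_n=\{\mathbf{0}\}$. A flow-up class basis of $R_G$ is a module basis consisting of one element from each flow-up class other than $\mathcal{F}_n$. For $F\in\mathcal{F}_i$ with $i<n$, the leading term $LT(F)=f_{i+1}$ is the first nonzero entry of $F$. For $0\le i<n$, let $L(\mathcal{F}_i)=\{LT(F):F\in\mathcal{F}_i\}\cup\{0\}$, which is an ideal of $R$. A spline $B\in\mathcal{F}_i$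 is a minimal element of $\mathcal{F}_i$ if $LT(B)$ generates the ideal $L(\mathcal{F}_i)$. *)

(* Defs.v *)
From HB Require Import structures.
From mathcomp Require Import all_boot all_order all_algebra.
From mathcomp Require Import boolp classical_sets.

Set Implicit Arguments.
Unset Strict Implicit.
Unset Printing Implicit Defensive.

Import GRing.Theory.

Local Open Scope classical_set_scope.
Local Open Scope ring_scope.

Section Ideals.
Variable R : comNzRingType.

Definition is_ideal (I : set R) : Prop :=
  I 0 /\ forall r x y, I x -> I y -> I (r * x + y).

Definition principal_ideal (a : R) : set R := [set x | exists r, x = r * a].

End Ideals.

(* R is already an integral domain. *)
Definition is_PID (R : idomainType) : Prop :=
  forall I : set R, is_ideal I -> exists a : R, I = principal_ideal a.

Section FreeModules.
Variables (R : pzRingType) (M : lmodType R).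

(* The index type may be infinite; linear combinations are finitely supported,
   along a sequence of indices. *)
Definition linearly_independent (I : choiceType) (b : I -> M) : Prop :=
  forall (s : seq I) (c : I -> R), uniq s ->
    \sum_(i <- s) c i *: b i = 0 -> forall i, i \in s -> c i = 0.

Definition generating (I : choiceType) (b : I -> M) : Prop :=
  forall v : M, exists (s : seq I) (c : I -> R), v = \sum_(i <- s) c i *: b i.

Definition module_basis (I : choiceType) (b : I -> M) : Prop :=
  linearly_independent b /\ generating b.

Definition free_module : Prop :=
  exists (I : choiceType) (b : I -> M), module_basis b.

End FreeModules.

(* An edge is sent to its set of two endpoints: loops are excluded, parallel
   edges (with possibly different labels) are allowed. *)
Record graph (n m : nat) := Graph {
  endpoints :> 'I_m -> {set 'I_n};
  card_endpoints : forall e, #|endpoints e| = 2 }.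

Definition adjacent n m (G : graph n m) : rel 'I_n :=
  fun u v => [exists e, G e == [set u; v]%SET].

(* As usual, a connected graph is nonempty. *)
Definition connected_graph n m (G : graph n m) : Prop :=
  (0 < n)%N /\ forall u v, connect (adjacent G) u v.

Section Splines.
Variables (R : idomainType) (n m : nat) (G : graph n m) (a : 'I_m -> R).

Definition is_spline (f : 'rV[R]_n) : Prop :=
  forall (e : 'I_m) (i j : 'I_n),
    G e = [set i; j]%SET -> principal_ideal (a e) (f 0 i - f 0 j).

Definition spline_pred : {pred 'rV[R]_n} := fun f => `[< is_spline f >].

Lemma spline_submod_closed : submod_closed spline_pred.
Proof.
split=> [|r f g /asboolP fS /asboolP gS]; apply/asboolP => e i j eij.
  by exists 0; rewrite !mxE subrr mul0r.
have [x fx] := fS e i j eij; have [y gy] := gS e i j eij.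
exists (r * x + y).
by rewrite !mxE opprD addrACA -mulrBr fx gy mulrDl mulrA.
Qed.

HB.instance Definition _ :=
  GRing.isSubmodClosed.Build R 'rV[R]_n spline_pred
    spline_submod_closed.

(* The module R_G, a submodule of R^n. *)
Record spline := Spline {
  spline_val :> 'rV[R]_n;
  _ : spline_val \in spline_pred }.

HB.instance Definition _ := [isSub for spline_val].
HB.instance Definition _ := [Choice of spline by <:].
HB.instance Definition _ := [SubChoice_isSubLmodule of spline by <:].

(* Vertices are numbered from 0, so that F 0 i is the entry following i leading
   entries; for i = n the second condition is void and the class is {0}. *)
Definition flow_up_class (i : nat) : set spline :=
  [set F | (forall j : 'I_n, (j < i)%N -> F 0 j = 0) /\
           (forall j : 'I_n, j = i :> nat -> F 0 j != 0)].

Definition leading_term (F : spline) : R :=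
  head 0 [seq x <- [seq F 0 j | j <- enum 'I_n] | x != 0].

Definition leading_ideal (i : nat) : set R :=
  [set leading_term F | F in flow_up_class i] `|` [set 0].

Definition minimal_element (i : nat) (B : spline) : Prop :=
  flow_up_class i B /\ principal_ideal (leading_term B) = leading_ideal i.

Definition flow_up_basis (B : 'I_n -> spline) : Prop :=
  module_basis B /\ forall i : 'I_n, flow_up_class i (B i).

Lemma leading_termE (i : 'I_n) (F : spline) :
  flow_up_class i F -> leading_term F = F 0 i.
Proof.
move=> [F0 Fi]; rewrite /leading_term.
have: i \in enum 'I_n by rewrite mem_enum.
have: sorted ltn (map val (enum 'I_n)) by rewrite val_enum_ord iota_ltn_sorted.
elim: (enum 'I_n) => //= j s IH js; rewrite in_cons.
have [<- _|ij /= si] := eqVneq i j; first by rewrite Fi.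
have jlt : (j < i)%N.
  have /allP := order_path_min ltn_trans js.
  by apply; apply: map_f.
rewrite F0 // eqxx /=; apply: IH => //; exact: path_sorted js.
Qed.

Lemma flow_up_class_last : flow_up_class n = [set 0].
Proof.
apply/seteqP; split=> [F [F0 _]|_ ->] /=.
  by apply/val_inj/rowP => j; rewrite F0 // mxE.
split=> j; first by rewrite mxE.
by move=> jn; have := ltn_ord j; rewrite jn ltnn.
Qed.

End Splines.

(* Main.v *)
Require Import Defs.
From mathcomp Require Import all_boot all_order all_algebra.
From mathcomp Require Import boolp classical_sets.

(** Flow-up splines behave like the rows of a triangular matrix: [B i] vanishes
    before vertex [i] and has a nonzero entry there.  Over a domain this alone
    gives linear independence ([flow_up_independent]): in a vanishing
    combination the coefficients are killed one at a time, from the first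
    vertex on.

    Minimality is what makes such a family generate ([minimal_generating]).  If
    a spline [F] vanishes before vertex [i], its entry at [i] lies in the ideal
    of leading terms, so it is a multiple of the entry of [B i], and subtracting
    that multiple of [B i] gives a spline that vanishes one vertex further.
    After all the vertices have been swept the remainder is zero.

    Minimal elements exist ([minimal_element_exists]) because the leading terms
    at [i] form an ideal, principal by hypothesis, whose generator is nonzero
    and hence is itself a leading term.  It is nonzero because placing the
    product of all the labels at vertex [i] and zero elsewhere is a spline, and
    that product is nonzero in a domain ([label_product_spline]). *)

Import GRing.Theory.

Local Open Scope classical_set_scope.
Local Open Scope ring_scope.

Section FlowUp.
Variables (R : idomainType) (n m : nat) (G : graph n m) (a : 'I_m -> R).

Local Notation spline := (spline G a).

Implicit Types (F : spline) (B : 'I_n -> spline).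

Lemma splineD F F' (j : 'I_n) : (F + F') 0 j = F 0 j + F' 0 j.
Proof. by rewrite -[spline_val _]/(val _) raddfD mxE. Qed.

Lemma splineZ r F (j : 'I_n) : (r *: F) 0 j = r * F 0 j.
Proof. by rewrite -[spline_val _]/(val _) linearZ mxE. Qed.

Lemma spline0 (j : 'I_n) : (0 : spline) 0 j = 0.
Proof. by rewrite -[spline_val _]/(val _) raddf0 mxE. Qed.

Lemma spline_sum (I : Type) (s : seq I) (E : I -> spline) (j : 'I_n) :
  (\sum_(i <- s) E i) 0 j = \sum_(i <- s) E i 0 j.
Proof.
exact: (big_morph (fun F : spline => F 0 j)
          (fun F F' => splineD F F' j) (spline0 j)).
Qed.

Definition vanishes_before (k : nat) F : Prop :=
  forall j : 'I_n, (j < k)%N -> F 0 j = 0.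

(** Splines that vanish before [i] form a submodule, unlike the flow-up class,
    and reading off the entry at [i] is linear on it, unlike the leading term;
    the splines that vanish at [i] too account for the adjoined 0. *)
Lemma leading_idealE (i : 'I_n) (x : R) :
  leading_ideal G a i x <-> exists2 F, vanishes_before i F & F 0 i = x.
Proof.
split=> [[[F [Fb Fi] <-]|->]|[F Fb <-]].
- by exists F; rewrite // (leading_termE (i := i)).
- by exists 0 => [j _|]; rewrite spline0.
have [->|Fi] := eqVneq (F 0 i) 0; first by right.
have FF : flow_up_class i F by split=> // j /val_inj ->.
by left; exists F => //; apply: leading_termE.
Qed.

Lemma leading_ideal_is_ideal (i : 'I_n) : is_ideal (leading_ideal G a i).
Proof.
split=> [|r x y /leading_idealE[F Fb <-] /leading_idealE[F' Fb' <-]].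
  by right.
apply/leading_idealE; exists (r *: F + F') => [j ji|].
  by rewrite splineD splineZ Fb // Fb' // mulr0 addr0.
by rewrite splineD splineZ.
Qed.

(** Every difference of two entries is 0 or plus or minus the product of the
    labels, so it is a multiple of each label. *)
Lemma label_product_spline (i : 'I_n) :
  (\prod_e a e) *: delta_mx 0 i \in spline_pred G a.
Proof.
apply/asboolP => e u v _; rewrite !mxE -mulrBr (bigD1 e) //= -mulrA mulrC.
by eexists.
Qed.

Lemma minimal_element_exists (i : 'I_n) :
  is_PID R -> (forall e, a e != 0) -> exists F, minimal_element i F.
Proof.
move=> R_PID a_neq0.
have [g gE] := R_PID _ (leading_ideal_is_ideal i).
have g_neq0 : g != 0.
  have prod_neq0 : \prod_e a e != 0 by apply/prodf_neq0.
  have : leading_ideal G a i (\prod_e a e).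
    apply/leading_idealE; exists (Spline (label_product_spline i)) => [j ji|].
      by rewrite /= !mxE -[j == i]/(val j == val i) ltn_eqF // andbF mulr0.
    by rewrite /= !mxE !eqxx mulr1.
  rewrite gE => -[r rE].
  by apply: contra_neq prod_neq0 => g0; rewrite rE g0 mulr0.
have : leading_ideal G a i g by rewrite gE; exists 1; rewrite mul1r.
move=> /leading_idealE[F Fb Fi].
have FF : flow_up_class i F by split=> // j /val_inj ->; rewrite Fi.
by exists F; split; rewrite // (leading_termE FF) Fi gE.
Qed.

Lemma flow_up_independent B :
  (forall i : 'I_n, flow_up_class i (B i)) -> linearly_independent B.
Proof.
move=> BF s c s_uniq sum0 i.
have [k] := ubnP (val i); elim: k i => // k IH i ik si.
have /eqP := congr1 (fun F : spline => F 0 i) sum0.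
rewrite spline0 spline_sum (bigD1_seq i) //= big_seq_cond big1 => [|j].
  have [_ Bi] := BF i.
  by rewrite addr0 splineZ mulf_eq0 (negPf (Bi i _)) // orbF => /eqP.
move=> /andP[sj ji]; rewrite splineZ.
have [lt_ji|lt_ij|/val_inj eq_ji] := ltngtP j i.
- by rewrite IH ?mul0r //; apply: leq_trans lt_ji _.
- by have [-> //] := BF j; rewrite mulr0.
- by rewrite eq_ji eqxx in ji.
Qed.

(** One step of the sweep: the entry at [i] is cancelled by [B i]. *)
Lemma minimal_element_reduction (i : 'I_n) (Bi F : spline) :
    minimal_element i Bi -> vanishes_before i F ->
  exists r, vanishes_before i.+1 (F - r *: Bi).
Proof.
move=> [BF BL] Fb.
have : leading_ideal G a i (F 0 i) by apply/leading_idealE; exists F.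
rewrite -BL (leading_termE BF) => -[r Fi]; exists r => j.
rewrite -scaleNr splineD splineZ ltnS leq_eqVlt => /predU1P[/val_inj ->|ji].
  by rewrite Fi mulNr subrr.
by case: BF => Bb _; rewrite Fb // Bb // mulr0 addr0.
Qed.

Lemma minimal_generating B :
  (forall i : 'I_n, minimal_element i (B i)) -> generating B.
Proof.
move=> Bmin F; exists (enum 'I_n).
(* Induction on the number k of vertices still to be swept. *)
suff sweep k : (k <= n)%N -> forall F', vanishes_before (n - k) F' ->
    exists c, F' = \sum_(i <- enum 'I_n) c i *: B i.
  by apply: (sweep n) => // j; rewrite subnn.
elim: k => [_|k IH kn] {}F Fb.
  exists (fun=> 0); rewrite big1 => [|i _]; last by rewrite scale0r.
  by apply/val_inj/rowP => j; rewrite Fb ?spline0 // subn0.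
have lt_n : (n - k.+1 < n)%N by rewrite ltn_subrL (leq_trans _ kn).
pose i := Ordinal lt_n.
have [r rF] := minimal_element_reduction i (B i) F (Bmin i) Fb.
have [|c cE] := IH (ltnW kn) (F - r *: B i).
  by rewrite -subSn // in rF.
exists (fun j => (if j == i then r else 0) + c j).
under eq_bigr do rewrite scalerDl.
rewrite big_split /= -cE (bigD1_seq i) ?mem_enum ?enum_uniq //= eqxx.
rewrite big1 => [|j /negPf ->]; last by rewrite scale0r.
by rewrite addr0 addrC subrK.
Qed.

Lemma minimal_flow_up_basis B :
  (forall i : 'I_n, minimal_element i (B i)) -> flow_up_basis B.
Proof.
move=> Bmin; have BF (i : 'I_n) : flow_up_class i (B i) by have [] := Bmin i.
split=> //; split; first exact: flow_up_independent.
exact: minimal_generating.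
Qed.

End FlowUp.

Theorem theorem3p3 (R : idomainType) (n m : nat) (G : graph n m)
    (a : 'I_m -> R)
    (R_PID : is_PID R)
    (G_connected : connected_graph G)
    (a_neq0 : forall e : 'I_m, a e != 0) :
  free_module (spline G a) /\
  (exists B : 'I_n -> spline G a, flow_up_basis B) /\
  (forall B : 'I_n -> spline G a,
     (forall i : 'I_n, minimal_element i (B i)) -> flow_up_basis B).
Proof.
have [B Bmin] := choice (fun i : 'I_n =>
  minimal_element_exists R n m G a i R_PID a_neq0).
have Bbasis := minimal_flow_up_basis _ _ _ _ _ B Bmin.
split; first by exists 'I_n, B; case: Bbasis.
by split; [exists B | exact: minimal_flow_up_basis].
Qed.
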